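(* Let $J(n,m,m+1)$ be the incidence graph of the Johnson geometry with $n\ge 3m$, let $|\Omega|=n$, $x\in\binom{\Omega}{m}$, let $\mathcal{T}=\mathcal{T}(x)$ be the Terwilliger algebra of $J(n,m,m+1)$ with respect to $x$, and let $\mathcal{M}$ be as defined in the context. Then $\mathcal{T}=\mathcal{M}$.
   Context: $J(n,m,m+1)$ is the bipartite graph with vertex set $X=\binom{\Omega}{m}\cup\binom{\Omega}{m+1}$ ($\binom{S}{k}$ = set of $k$-subsets of $S$), $y\in\binom{\Omega}{m}$ adjacent to $z\in\binom{\Omega}{m+1}$ iff $y\subseteq z$; $A$ is its adjacency matrix. $\Gamma_k(x)$ is the set of vertices at distance $k$ from $x$; for $n\ge 2m+1$ the maximal distance from $x$ is $2m+1$, and $\Gamma_{2i}(x)=\{y\in\binom{\Omega}{m}:|x\cap y|=m-i\}$, $\Gamma_{2i+1}(x)=\{z\in\binom{\Omega}{m+1}:|x\cap z|=m-i\}$. $E^*_k$ is the diagonal $0/1$ matrix with $(y,y)$-entry $1$ iff $y\in\Gamma_k(x)$. The Terwilliger algebra $\mathcal{T}(x)$ is the subalgebra of $\mathrm{Mat}_X(\mathbb{C})$ generated by $A,E^*_0,\dots,E^*_{2m+1}$. A vertex $y\in\Gamma_k(x)$ is identified with $(y\cap x,y\setminus x)\in\binom{x}{m-\lfloor k/2\rfloor}\times\binom{\Omega\setminus x}{\lceil k/2\rceil}$, and $P\otimes Q$ is the Kronecker product with $(P\otimes Q)_{(\alpha,\beta),(\alpha',\beta')}=P_{\alpha\alpha'}Q_{\beta\beta'}$.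 For a set $V$ of size $v$, $C^l_{i,j}(v)$ is the matrix with rows indexed by $\binom{V}{i}$, columns by $\binom{V}{j}$, entry $\binom{|y\cap z|}{l}$; here $V=x$ ($v=m$) in the first factor and $V=\Omega\setminus x$ ($v=n-m$) in the second. For $M$ indexed by $\Gamma_i(x)\times\Gamma_j(x)$, $L(M)\in\mathrm{Mat}_X(\mathbb{C})$ has $\Gamma_i(x)\times\Gamma_j(x)$ block $M$ and all other blocks $0$. For $0\le i,j\le 2m+1$, $\mathcal{M}_{i,j}=\mathrm{Span}\{C^l_{m-\lfloor i/2\rfloor,m-\lfloor j/2\rfloor}(m)\otimes C^s_{\lceil i/2\rceil,\lceil j/2\rceil}(n-m): 0\le l\le\min(m-\lfloor i/2\rfloor,m-\lfloor j/2\rfloor),\ 0\le s\le\min(\lceil i/2\rceil,\lceil j/2\rceil)\}$ and $\mathcal{M}=\bigoplus_{i,j=0}^{2m+1}L(\mathcal{M}_{i,j})$, where $L(\mathcal{M}_{i,j})=\{L(M):M\in\mathcal{M}_{i,j}\}$. *)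

(* Defs.v *)
From HB Require Import structures.
From mathcomp Require Import all_boot all_order all_algebra.
From mathcomp Require Import boolp classical_sets reals.
From mathcomp Require Import complex mxtens.
From mathcomp Require Import zify.

Set Implicit Arguments.
Unset Strict Implicit.
Unset Printing Implicit Defensive.

Import GRing.Theory.
Local Open Scope ring_scope.

Section GraphDistance.

Variables (T : finType) (e : rel T).

Definition walk (k : nat) (u v : T) : bool :=
  [exists p : k.-tuple T, path e u p && (last u p == v)].

Definition Gamma (k : nat) (u : T) : {set T} :=
  [set v | walk k u v && [forall j : 'I_k, ~~ walk j u v]].

End GraphDistance.

Section SubalgebraGenerated.

Variables (F : fieldType) (N : nat).

(* 'M_N is not an lalgType when N may be 0, hence no GRing.subalg_closed. *)
Definition is_subalgebra (S : set 'M[F]_N) : Prop :=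
  [/\ S 1%:M,
      forall (a : F) (P Q : 'M[F]_N), S P -> S Q -> S (a *: P + Q)
    & forall P Q : 'M[F]_N, S P -> S Q -> S (P *m Q)].

Definition subalgebra_gen (G : set 'M[F]_N) : set 'M[F]_N :=
  smallest is_subalgebra G.

End SubalgebraGenerated.

Notation ksub V k := {y : {set _} | (y \subset V) && (#|y| == k)}.

Section Subsets.

Variable Omega : finType.

Definition Cmx (F : fieldType) (V : {set Omega}) (i j l : nat) :
    'M[F]_(#|{: ksub V i}|, #|{: ksub V j}|) :=
  \matrix_(a, b) 'C(#|val (enum_val a) :&: val (enum_val b)|, l)%:R.

End Subsets.

Notation vertex Omega m :=
  {y : {set Omega} | (#|y| == m) || (#|y| == m.+1)}.

Section JohnsonIncidence.

Variables (Omega : finType) (m : nat).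

Local Notation X := (vertex Omega m).

Definition adj : rel X := fun y z =>
  [&& #|val y| == m, #|val z| == m.+1 & val y \subset val z] ||
  [&& #|val z| == m, #|val y| == m.+1 & val z \subset val y].

(* dval x y is the distance from x to y when #|val x| = m; see in_Gamma. *)
Definition dval (x y : X) : nat :=
  (2 * #|val y :\: val x| - (#|val y| == m.+1))%N.

Lemma dval_up (x y z : X) :
  #|val x| = m -> #|val y| = m -> #|val z| = m.+1 -> val y \subset val z ->
  (dval x z <= (dval x y).+1)%N /\ (dval x y <= (dval x z).+1)%N.
Proof.
move=> xm ym zm yz; rewrite /dval ym zm eqxx.
have -> : (m == m.+1) = false by lia.
have zD : #|val z :\: val y| = 1%N.
  by have := cardsID (val y) (val z); rewrite (finset.setIidPr yz) ym zm; lia.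
have le1 : (#|val y :\: val x| <= #|val z :\: val x|)%N.
  by rewrite subset_leq_card // finset.setSD.
have le2 : (#|val z :\: val x| <= #|val y :\: val x| + #|val z :\: val y|)%N.
  apply: leq_trans (leq_card_setU _ _); apply: subset_leq_card.
  by apply/fintype.subsetP => w; rewrite !inE; do 3 case: (w \in _).
by rewrite zD in le2; split; lia.
Qed.

Lemma dval_adj (x y z : X) : #|val x| = m -> adj y z ->
  (dval x z <= (dval x y).+1)%N.
Proof.
move=> xm /orP[]/and3P[/eqP h1 /eqP h2 h3]; first by have [] := dval_up xm h1 h2 h3.
by have [] := dval_up xm h1 h2 h3.
Qed.

Lemma dval0 (x y : X) : #|val x| = m -> dval x y = 0%N -> y = x.
Proof.
move=> xm; rewrite /dval => d0.
have /orP[/eqP ym|/eqP ym] := valP y; last first.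
  have := subset_leq_card (finset.subsetIr (val y) (val x)).
  by have := cardsID (val x) (val y); move: d0; rewrite ym xm eqxx; lia.
apply/val_inj/eqP; rewrite eqEcard xm ym leqnn andbT -finset.setD_eq0 -cards_eq0.
by move: d0; rewrite ym; lia.
Qed.

Lemma dval_pred (x y : X) k : #|val x| = m -> dval x y = k.+1 ->
  exists2 z : X, adj z y & dval x z = k.
Proof.
move=> xm; rewrite /dval => dk.
have /card_gt0P [b by_] : (0 < #|val y :\: val x|)%N by lia.
have yID := cardsID (val x) (val y).
have /orP[/eqP ym|/eqP ym] := valP y.
  have xID := cardsID (val y) (val x); rewrite finset.setIC in xID.
  have /card_gt0P [c] : (0 < #|val x :\: val y|)%N.
    by have : (0 < #|val y :\: val x|)%N; [apply/card_gt0P; exists b | lia].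
  rewrite inE => /andP[cy cx].
  have cz : #|c |: val y| = m.+1 by rewrite cardsU1 cy ym.
  have zP : (#|c |: val y| == m) || (#|c |: val y| == m.+1).
    by rewrite cz eqxx orbT.
  exists (exist _ (c |: val y) zP).
    by rewrite /adj /= ym cz !eqxx finset.subsetUr orbT.
  have -> : val (exist _ (c |: val y) zP : X) = c |: val y by [].
  have -> : (c |: val y) :\: val x = val y :\: val x.
    apply/finset.setP => w; rewrite !inE.
    by case: (eqVneq w c) => [->|]; rewrite ?cx.
  by move: dk; rewrite cz ym eqxx; lia.
move: (by_); rewrite inE => /andP[bx by1].
have cz : #|val y :\ b| = m.
  by have := cardsD1 b (val y); rewrite by1 ym; lia.
have zP : (#|val y :\ b| == m) || (#|val y :\ b| == m.+1) by rewrite cz eqxx.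
exists (exist _ (val y :\ b) zP).
  by rewrite /adj /= ym cz !eqxx finset.subD1set.
have -> : val (exist _ (val y :\ b) zP : X) = val y :\ b by [].
have -> : (val y :\ b) :\: val x = (val y :\: val x) :\ b.
  by apply/finset.setP => w; rewrite !inE; do 2 case: (_ \in _); rewrite ?andbF ?andbT.
have := cardsD1 b (val y :\: val x); rewrite by_.
by move: dk; rewrite cz ym eqxx; lia.
Qed.

Lemma walk_dval (x y : X) : #|val x| = m -> walk adj (dval x y) x y.
Proof.
move=> xm; move: {2}(dval x y) (erefl (dval x y)) => k dk.
rewrite dk; elim: k y dk => [|k IH] y dk.
  by apply/existsP; exists [tuple]; rewrite /= (dval0 xm dk) eqxx.
have [z zy /IH /existsP[p /andP[pp /eqP lp]]] := dval_pred xm dk.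
apply/existsP; exists [tuple of rcons p y].
by rewrite /= rcons_path last_rcons pp lp zy eqxx.
Qed.

Lemma dval_walk (x y : X) k : #|val x| = m -> walk adj k x y ->
  (dval x y <= k)%N.
Proof.
move=> xm /existsP[p /andP[pp /eqP <-]].
have dx : dval x x = 0%N by rewrite /dval finset.setDv cards0; lia.
have gen (s : seq X) u : path adj u s ->
    (dval x (last u s) <= dval x u + size s)%N.
  elim: s u => [|v s IH] u /=; first by rewrite addn0.
  case/andP=> uv /IH; have := dval_adj xm uv; lia.
by have := gen p x pp; rewrite dx size_tuple.
Qed.

Lemma in_Gamma (x y : X) k : #|val x| = m ->
  (y \in Gamma adj k x) = (dval x y == k).
Proof.
move=> xm; rewrite inE; apply/andP/eqP => [[wk /forallP nw]|<-].
  have := dval_walk xm wk; rewrite leq_eqVlt => /orP[/eqP //|lt].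
  by have := nw (Ordinal lt); rewrite /= walk_dval.
split; first exact: walk_dval.
apply/forallP => j; apply/negP => /(dval_walk xm).
by rewrite leqNgt ltn_ord.
Qed.

Lemma in_Gamma_even (x y : X) i : #|val x| = m -> (i <= m)%N ->
  (y \in Gamma adj i.*2 x) =
  (#|val y| == m) && (#|val x :&: val y| == m - i)%N.
Proof.
move=> xm im; rewrite in_Gamma // /dval finset.setIC.
have := subset_leq_card (finset.subsetIr (val y) (val x)); rewrite xm.
have := cardsID (val x) (val y); have /orP[/eqP ->|/eqP ->] := valP y; lia.
Qed.

Lemma in_Gamma_odd (x y : X) i : #|val x| = m -> (i <= m)%N ->
  (y \in Gamma adj i.*2.+1 x) =
  (#|val y| == m.+1) && (#|val x :&: val y| == m - i)%N.
Proof.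
move=> xm im; rewrite in_Gamma // /dval finset.setIC.
have := subset_leq_card (finset.subsetIr (val y) (val x)); rewrite xm.
have := cardsID (val x) (val y); have /orP[/eqP ->|/eqP ->] := valP y; lia.
Qed.

Variable F : fieldType.

Local Notation MatX := 'M[F]_#|{: X}|.

Definition adjmx : MatX := \matrix_(a, b) (adj (enum_val a) (enum_val b))%:R.

Variable x : X.

Definition Estar (k : nat) : MatX :=
  \matrix_(a, b) ((a == b) && (enum_val a \in Gamma adj k x))%:R.

Definition Terwilliger : set MatX :=
  subalgebra_gen [set B | B = adjmx \/ exists k : 'I_(2 * m + 2), B = Estar k].

Local Notation inner k := (ksub (val x) (m - k./2)%N).
Local Notation outer k := (ksub (~: val x) (uphalf k)).

(* The product inner k * outer k is indexed through mxtens_index, as the rows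
   and columns of a Kronecker product *t are. *)
Definition psize (k : nat) : nat := (#|{: inner k}| * #|{: outer k}|)%N.

(* y |-> (y :&: x, y :\: x); a bijection from Gamma_k(x), by ident_isSome
   and ident_bij. *)
Definition ident (k : nat) (y : X) : option 'I_(psize k) :=
  if y \in Gamma adj k x then
    if insub (val y :&: val x) is Some p then
      if insub (val y :\: val x) is Some q then
        Some (mxtens_index (enum_rank (p : inner k), enum_rank (q : outer k)))
      else None
    else None
  else None.

Definition Lmx (i j : nat) (M : 'M[F]_(psize i, psize j)) : MatX :=
  \matrix_(a, b)
    if ident i (enum_val a) is Some r then
      if ident j (enum_val b) is Some s then M r s else 0
    else 0.

Lemma Lmx_is_linear i j : linear (@Lmx i j).
Proof.
move=> c M P; apply/matrixP => a b; rewrite !mxE.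
case: (ident i (enum_val a)) => [r|]; last by rewrite mulr0 addr0.
by case: (ident j (enum_val b)) => [s|]; rewrite ?mxE ?mulr0 ?addr0.
Qed.

HB.instance Definition _ i j :=
  GRing.isLinear.Build F 'M[F]_(psize i, psize j) MatX _ (@Lmx i j)
    (@Lmx_is_linear i j).

Definition Mblock (i j : nat) : {vspace 'M[F]_(psize i, psize j)} :=
  <<[seq Cmx F (val x) (m - i./2) (m - j./2) l
           *t Cmx F (~: val x) (uphalf i) (uphalf j) s
      | l <- iota 0 (minn (m - i./2) (m - j./2)).+1,
        s <- iota 0 (minn (uphalf i) (uphalf j)).+1]>>%VS.

Definition Mspace : {vspace MatX} :=
  (\sum_(p : 'I_(2 * m + 2) * 'I_(2 * m + 2))
     (linfun (@Lmx p.1 p.2) @: Mblock p.1 p.2))%VS.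

Hypothesis xm : #|val x| = m.

Lemma ident_Some k (y : X) r : ident k y = Some r <->
  [/\ y \in Gamma adj k x,
      val (enum_val (mxtens_unindex r).1 : inner k) = val y :&: val x
    & val (enum_val (mxtens_unindex r).2 : outer k) = val y :\: val x].
Proof.
rewrite /ident; case: ifP => [_|_]; last by split => // -[].
split.
  case: insubP => // p _ vp; case: insubP => // q _ vq [<-].
  by rewrite mxtens_indexK !enum_rankK vp vq.
case=> _ e1 e2.
rewrite -e1 -e2 !valK; congr Some.
by rewrite !enum_valK -[RHS]mxtens_unindexK; congr mxtens_index; case: mxtens_unindex.
Qed.

Lemma ident_isSome k (y : X) : isSome (ident k y) = (y \in Gamma adj k x).
Proof.
rewrite /ident; case: ifP => // yk.
have /eqP dk : dval x y == k by rewrite -in_Gamma.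
have yID := cardsID (val x) (val y).
have yI := subset_leq_card (finset.subsetIr (val y) (val x)); rewrite xm in yI.
case: insubP => [p _ _|/negP[]]; last first.
  rewrite finset.subsetIr andTb; move: dk; rewrite /dval.
  by have /orP[/eqP e|/eqP e] := valP y; rewrite e; rewrite e in yID; lia.
case: insubP => // /negP[].
rewrite {1}finset.setDE finset.subsetIr andTb; move: dk; rewrite /dval.
by have /orP[/eqP e|/eqP e] := valP y; rewrite e; rewrite e in yID; lia.
Qed.

Lemma ident_bij k : (k < 2 * m + 2)%N -> forall r : 'I_(psize k),
  exists! y : X, ident k y = Some r.
Proof.
move=> lk r.
set p := enum_val (mxtens_unindex r).1 : inner k.
set q := enum_val (mxtens_unindex r).2 : outer k.
have /andP[px /eqP pm] := valP p; have /andP[qx /eqP qm] := valP q.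
have Ix : (val p :|: val q) :&: val x = val p.
  apply/finset.setP => w; rewrite !inE.
  have /implyP := fintype.subsetP px w; have /implyP := fintype.subsetP qx w.
  by rewrite !inE; do 3 case: (w \in _).
have Dx : (val p :|: val q) :\: val x = val q.
  apply/finset.setP => w; rewrite !inE.
  have /implyP := fintype.subsetP px w; have /implyP := fintype.subsetP qx w.
  by rewrite !inE; do 3 case: (w \in _).
have := cardsID (val x) (val p :|: val q); rewrite Ix Dx pm qm => card.
have yP : (#|val p :|: val q| == m) || (#|val p :|: val q| == m.+1) by lia.
pose y : X := exist _ (val p :|: val q) yP.
have vy : val y = val p :|: val q by [].
exists y; split.
  apply/ident_Some; rewrite in_Gamma // /dval vy Ix Dx qm.
  by split=> //; case/orP: (yP) => /eqP yc; rewrite yc ?eqxx; lia.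
move=> z /ident_Some[_ e1 e2]; apply: val_inj => /=.
by rewrite -[RHS](finset.setID _ (val x)) -e1 -e2.
Qed.

Lemma Gamma_ord_inj N (y : X) (i j : 'I_N) :
  y \in Gamma adj i x -> y \in Gamma adj j x -> i = j.
Proof.
have yE k : y \in Gamma adj k x -> dval x y = k.
  by move=> yk; apply/eqP; rewrite -(in_Gamma y k xm).
by move=> /yE iE /yE jE; apply: ord_inj; rewrite -iE -jE.
Qed.

(* The blocks L(M_ij) are in direct sum, so Mspace is \bigoplus_ij L(M_ij). *)
Lemma directv_Mspace :
  directv (\sum_(p : 'I_(2 * m + 2) * 'I_(2 * m + 2))
             (linfun (@Lmx p.1 p.2) @: Mblock p.1 p.2))%VS.
Proof.
apply/directv_sum_independent => u uV u0 p _.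
have uL q a b : u q a b != 0 ->
    enum_val a \in Gamma adj q.1 x /\ enum_val b \in Gamma adj q.2 x.
  have /memv_imgP[M _ ->] := uV q isT; rewrite lfunE /= mxE.
  case E1: (ident q.1 _) => [r|]; last by rewrite eqxx.
  case E2: (ident q.2 _) => [s|]; last by rewrite eqxx.
  by move=> _; rewrite -!ident_isSome E1 E2.
apply/matrixP => a b; rewrite [RHS]mxE; apply/eqP; apply: contraT => nz.
have /matrixP/(_ a b) := u0; rewrite summxE [RHS]mxE (bigD1 p) //= big1 ?addr0.
  by move/eqP; rewrite (negPf nz).
move=> q /negP qp; apply/eqP; apply: contraT => nzq; case: qp.
have [a1 b1] := uL _ _ _ nz; have [a2 b2] := uL _ _ _ nzq.
by rewrite [q]surjective_pairing [p]surjective_pairing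
  (Gamma_ord_inj a2 a1) (Gamma_ord_inj b2 b1).
Qed.

End JohnsonIncidence.

Arguments Terwilliger {Omega m} F x.
Arguments Mspace {Omega m} F x.

(* Main.v *)
(* Write G(k,k',l,s) for L(C^l (x) C^s) placed in block (k,k').  Going from
   level k' to a neighbouring level deletes or adds one point, either inside or
   outside x.  Hence, with V one of x and its complement, multiplying G(k,k',l,s)
   on the right by A and projecting onto a neighbouring level leaves one tensor
   factor alone and acts on the other, when a point of V is deleted or added, by
     C^l |-> (|z :&: V| - l) C^l,
     C^l |-> (|V| - |z :&: V| - l) C^l + (|y :&: V| - l + 1) C^(l-1)
   respectively, where y and z are the row and column indices of the result.
   So M is stable under right multiplication by the generators and contains 1,
   whence T <= M.  Conversely, a step to a neighbouring level and back sends a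
   diagonal block C^l to a combination of C^l and C^(l-1) in which C^(l-1) has a
   nonzero coefficient; descending from E*_k = G(k,k,m-k/2,uphalf k), all the
   diagonal blocks lie in T.  Single steps then carry block (k,k') to block
   (k,k'+1) for k <= k', and transposition yields the remaining blocks. *)
Require Import Defs.
From HB Require Import structures.
From mathcomp Require Import all_boot all_order all_algebra.
From mathcomp Require Import boolp classical_sets reals.
From mathcomp Require Import complex mxtens.
From mathcomp Require Import zify ring.

Set Implicit Arguments.
Unset Strict Implicit.
Unset Printing Implicit Defensive.

Import GRing.Theory Num.Theory.
Local Open Scope ring_scope.

Lemma sumr_card_const (F : nzSemiRingType) (T : finType) (A : {pred T}) (c : F) :
  \sum_(i in A) c = #|A|%:R * c.
Proof. by rewrite sumr_const mulr_natl. Qed.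

(** * Binomial sums over the points deleted from or added to a set *)

Section Binomials.

Variable F : numFieldType.

Lemma natr_mul_bin_down (n l : nat) :
  n%:R * 'C(n.-1, l)%:R = (n%:R - l%:R) * 'C(n, l)%:R :> F.
Proof.
have [ln|nl] := leqP l n; last by rewrite -natrM mul_bin_down !bin_small ?muln0 ?mulr0.
by rewrite -natrM mul_bin_down natrM natrB.
Qed.

(* The factors (l != 0)%:R here and below cancel the junk value 0.-1 = 0. *)
Lemma natr_bin_pred (n l : nat) :
  ('C(n.+1, l)%:R : F) = 'C(n, l)%:R + (l != 0)%:R * 'C(n, l.-1)%:R.
Proof. by case: l => [|l]; rewrite ?bin0 ?mul0r ?addr0 // binS natrD mul1r. Qed.

Lemma natr_mul_bin_left (n l : nat) :
  l%:R * 'C(n, l)%:R = (l != 0)%:R * (n%:R - l.-1%:R) * 'C(n, l.-1)%:R :> F.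
Proof.
case: l => [|l]; first by rewrite !mul0r.
rewrite mul1r /= -natrM mul_bin_left.
have [ln|nl] := leqP l n; first by rewrite natrM natrB.
by rewrite bin_small ?muln0 ?mulr0.
Qed.

Variables (Omega : finType) (V y z : {set Omega}) (l : nat).

(** Put c = |y ∩ z ∩ V|. The points [e] in [y] shrink the intersection by one and contribute
    c·C(c-1,l) = (c-l)·C(c,l); the other |z ∩ V| - c points leave it alone. Hence c cancels from the
    total coefficient. *)
Lemma sum_bin_remove :
  \sum_(e in z :&: V) 'C(#|y :&: (z :\ e) :&: V|, l)%:R =
  (#|z :&: V|%:R - l%:R) * 'C(#|y :&: z :&: V|, l)%:R :> F.
Proof.
rewrite (big_setID y) /=.
rewrite (eq_bigr (fun _ => 'C(#|y :&: z :&: V|.-1, l)%:R)); last first.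
  move=> e; rewrite !inE => /andP[/andP[ez eV] ey]; congr ('C(_, _)%:R).
  have -> : y :&: (z :\ e) :&: V = (y :&: z :&: V) :\ e.
    by apply/finset.setP => w; rewrite !inE; case: (w == e); rewrite ?andbF.
  by rewrite (cardsD1 e (y :&: z :&: V)) !inE ey ez eV.
rewrite [X in _ + X](eq_bigr (fun _ => 'C(#|y :&: z :&: V|, l)%:R)); last first.
  move=> e; rewrite !inE => /andP[ey _]; congr ('C(_, _)%:R).
  congr #|pred_of_set _|; apply/finset.setP => w; rewrite !inE.
  by case: eqP => // ->; rewrite (negPf ey).
rewrite !sumr_card_const.
have -> : z :&: V :&: y = y :&: z :&: V.
  by apply/finset.setP => w; rewrite !inE; do 3 case: (w \in _).
rewrite natr_mul_bin_down -mulrDl; congr (_ * _).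
rewrite -(cardsID y (z :&: V)) natrD.
have -> : z :&: V :&: y = y :&: z :&: V.
  by apply/finset.setP => w; rewrite !inE; do 3 case: (w \in _).
ring.
Qed.

(** With c = |y ∩ z ∩ V|, each added point of [y] brings in C(c,l-1) by Pascal's rule, with
    multiplicity |y ∩ V| - c. The identity l·C(c,l) = (c-l+1)·C(c,l-1) then trades the dependence of
    this coefficient on c for a multiple of C(c,l). *)
Lemma sum_bin_add :
  \sum_(e in V :\: z) 'C(#|y :&: (e |: z) :&: V|, l)%:R =
  (#|V|%:R - #|z :&: V|%:R - l%:R) * 'C(#|y :&: z :&: V|, l)%:R +
  (l != 0)%:R * (#|y :&: V|%:R - l.-1%:R) * 'C(#|y :&: z :&: V|, l.-1)%:R :> F.
Proof.
rewrite (big_setID y) /=.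
rewrite (eq_bigr (fun _ => 'C(#|y :&: z :&: V|.+1, l)%:R)); last first.
  move=> e; rewrite !inE => /andP[/andP[ez eV] ey]; congr ('C(_, _)%:R).
  have -> : y :&: (e |: z) :&: V = e |: (y :&: z :&: V).
    by apply/finset.setP => w; rewrite !inE; case: eqP => [->|] //=; rewrite eV ey.
  by rewrite cardsU1 !inE (negPf ez) andbF.
rewrite [X in _ + X](eq_bigr (fun _ => 'C(#|y :&: z :&: V|, l)%:R)); last first.
  move=> e; rewrite !inE => /andP[ey _]; congr ('C(_, _)%:R).
  congr #|pred_of_set _|; apply/finset.setP => w; rewrite !inE.
  by case: eqP => // ->; rewrite (negPf ey).
rewrite !sumr_card_const natr_bin_pred.
set c := 'C(_, l)%:R; set c' := 'C(_, l.-1)%:R.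
have cD : (#|V| = #|z :&: V| + #|(V :\: z) :&: y| + #|V :\: z :\: y|)%N.
  by rewrite -(cardsID z V) -(cardsID y (V :\: z)) finset.setIC addnA.
have cI : (#|y :&: V| = #|y :&: z :&: V| + #|(V :\: z) :&: y|)%N.
  rewrite -(cardsID z (y :&: V)); congr (_ + _)%N; congr #|pred_of_set _|;
  by apply/finset.setP => w; rewrite !inE; do 3 case: (w \in _).
have := natr_mul_bin_left #|y :&: z :&: V| l; rewrite -/c -/c' => E.
have {}E : l%:R * c = (l != 0)%:R * ((#|y :&: z :&: V|%:R - l.-1%:R) * c').
  by rewrite E mulrA.
rewrite cD cI !natrD; ring: E.
Qed.

End Binomials.

Lemma cardD1_succ (T : finType) (A : {set T}) (e : T) (k : nat) :
  e \in A -> #|A| = k.+1 -> #|A :\ e| = k.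
Proof. by move=> eA; rewrite (cardsD1 e) eA => -[]. Qed.

(** * Sums over neighbours as sums over points *)

Section Neighbours.

Variables (Omega : finType) (m : nat) (R : nmodType).
Local Notation X := (vertex Omega m).

Lemma sum_adj_remove (z : X) (f : {set Omega} -> R) : #|val z| = m.+1 ->
  \sum_(w : X | adj w z) f (val w) = \sum_(e in val z) f (val z :\ e).
Proof.
(* The default [z] of [insubd] is never reached for [e] in [val z]; [h] is a bijection from [val z]
   onto the neighbours, each of which misses exactly one point. *)
move=> zm; pose h e : X := insubd z (val z :\ e).
have hE e : e \in val z -> val (h e) = val z :\ e.
  move=> ez; rewrite /h val_insubd.
  by rewrite (cardD1_succ ez zm) eqxx.
rewrite [RHS](eq_bigr (fun e => f (val (h e)))); last by move=> e /hE ->.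
rewrite -[RHS](big_imset (fun w => f (val w))); last first.
  move=> e e' ez e'z hh; have := hE e ez; rewrite hh hE // => /finset.setP/(_ e).
  by rewrite !inE eqxx ez andbT /=; case: eqP.
apply: eq_bigl => w; apply/idP/imsetP => [|[e ez ->]]; last first.
  rewrite /adj hE // zm eqxx finset.subD1set.
  by rewrite (cardD1_succ ez zm) eqxx.
rewrite /adj zm !eqxx /=; case/orP => [/andP[/eqP wm wz]|]; last first.
  by case/andP=> /eqP ?; lia.
have /card_gt0P[e] : (0 < #|val z :\: val w|)%N.
  by have := cardsID (val w) (val z); rewrite (finset.setIidPr wz) wm zm; lia.
rewrite inE => /andP[ew ez]; exists e => //; apply: val_inj; rewrite hE //.
apply/eqP; rewrite eqEcard subsetD1 wz ew /= wm.
by rewrite (cardD1_succ ez zm).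
Qed.

Lemma sum_adj_add (z : X) (f : {set Omega} -> R) : #|val z| = m ->
  \sum_(w : X | adj w z) f (val w) = \sum_(e in ~: val z) f (e |: val z).
Proof.
move=> zm; pose h e : X := insubd z (e |: val z).
have hE e : e \in ~: val z -> val (h e) = e |: val z.
  rewrite inE => ez; rewrite /h val_insubd.
  by have := cardsU1 e (val z); rewrite ez zm => ->; rewrite eqxx orbT.
rewrite [RHS](eq_bigr (fun e => f (val (h e)))); last by move=> e /hE ->.
rewrite -[RHS](big_imset (fun w => f (val w))); last first.
  move=> e e' ez e'z hh; have := hE e ez; rewrite hh hE // => /finset.setP/(_ e).
  by move: ez; rewrite !inE eqxx /=; case: eqP => //= _ /negPf ->.
apply: eq_bigl => w; apply/idP/imsetP => [|[e ez ->]]; last first.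
  rewrite /adj hE // zm eqxx finset.subsetUr.
  by move: ez; rewrite inE => ez; rewrite cardsU1 ez zm eqxx orbT.
rewrite /adj zm !eqxx /=; case/orP => [/andP[_ /andP[/eqP mm _]]|]; first by lia.
case/andP=> [/eqP wm zw].
have /card_gt0P[e] : (0 < #|val w :\: val z|)%N.
  by have := cardsID (val z) (val w); rewrite (finset.setIidPr zw) wm zm; lia.
rewrite inE => /andP[ez ew]; exists e; first by rewrite inE.
apply: val_inj; rewrite hE ?inE //; apply/esym/eqP.
by rewrite eqEcard finset.subUset finset.sub1set ew zw cardsU1 ez wm zm add1n leqnn.
Qed.

End Neighbours.

(** * Distance levels, and products of blocks with the generators *)

Section Blocks.

Variables (Omega : finType) (m : nat) (F : numFieldType).
Local Notation X := (vertex Omega m).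
Local Notation MatX := 'M[F]_#|{: X}|.

Variable x : X.
Hypothesis xm : #|val x| = m.

Lemma dvalE (y : X) k : (dval x y == k) =
  (#|val y| == m + odd k)%N && (#|val y :&: ~: val x| == uphalf k).
Proof.
rewrite /dval -finset.setDE; have /orP[/eqP e|/eqP e] := valP y; rewrite e.
  by lia.
(* A set of size m+1 has a point outside [x], so the truncated subtraction in [dval] is exact. *)
have := cardsID (val x) (val y); rewrite e.
have := subset_leq_card (finset.subsetIr (val y) (val x)); rewrite xm; lia.
Qed.

Lemma card_dval (y : X) k : dval x y = k ->
  [/\ #|val y| = (m + odd k)%N, #|val y :&: val x| = (m - k./2)%N
    & #|val y :&: ~: val x| = uphalf k].
Proof.
move=> /eqP; rewrite dvalE => /andP[/eqP yk /eqP yD]; split=> //.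
have := cardsID (val x) (val y); rewrite finset.setDE yk yD; lia.
Qed.

Lemma dval_lt (y : X) : (dval x y < 2 * m + 2)%N.
Proof.
have [yk yI yD] := card_dval (erefl (dval x y)).
have := cardsID (val x) (val y); rewrite finset.setDE yk yI yD; lia.
Qed.

(** The distances differ by at most one, and they cannot be equal because the parity of the distance
    is determined by the size of the vertex. *)
Lemma adj_dval (y z : X) : adj y z ->
  dval x z = (dval x y).+1 \/ dval x y = (dval x z).+1.
Proof.
move=> yz; have := dval_adj xm yz.
have zy : adj z y by move: yz; rewrite /adj orbC.
have := dval_adj xm zy.
have [yk _ _] := card_dval (erefl (dval x y)).
have [zk _ _] := card_dval (erefl (dval x z)).
by move: yz; rewrite /adj yk zk; lia.
Qed.

(* Equal to L(C^l (x) C^s) by Lmx_tens, but without the reindexing through ident. *)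
Definition block (k k' l s : nat) : MatX :=
  \matrix_(a, b) (((dval x (enum_val a) == k) && (dval x (enum_val b) == k'))%:R *
   ('C(#|val (enum_val a) :&: val (enum_val b) :&: val x|, l)%:R *
    'C(#|val (enum_val a) :&: val (enum_val b) :&: ~: val x|, s)%:R)).

Lemma mulmx_Estar (B : MatX) k a b :
  (B *m Estar F x k) a b = (dval x (enum_val b) == k)%:R * B a b.
Proof.
rewrite mxE (bigD1 b) //= big1 ?addr0 => [|c /negPf cb]; last first.
  by rewrite mxE cb mulr0.
by rewrite mxE eqxx /= in_Gamma // mulrC.
Qed.

Lemma block_Estar k k' k'' l s :
  block k k' l s *m Estar F x k'' = (k' == k'')%:R *: block k k' l s.
Proof.
apply/matrixP => a b; rewrite mulmx_Estar !mxE.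
case: (dval x (enum_val a) == k); rewrite ?mul0r ?mulr0 //=.
case: (eqVneq (dval x (enum_val b)) k') => [->|_] //.
by rewrite !mul0r !mulr0.
Qed.

Lemma block_adj_Estar k k' k'' l s a b :
  (block k k' l s *m adjmx Omega m F *m Estar F x k'') a b =
  ((dval x (enum_val a) == k) && (dval x (enum_val b) == k''))%:R *
  \sum_(w : X | adj w (enum_val b)) (dval x w == k')%:R *
   ('C(#|val (enum_val a) :&: val w :&: val x|, l)%:R *
    'C(#|val (enum_val a) :&: val w :&: ~: val x|, s)%:R).
Proof.
rewrite mulmx_Estar andbC -mulnb natrM -!mulrA; congr (_ * _).
rewrite mxE big_distrr /= [RHS]big_mkcond /=.
rewrite [RHS](reindex _ (onW_bij _ (@enum_val_bij X))) /=.
apply: eq_bigr => c _; rewrite !mxE; case: adj; rewrite ?mulr0 // mulr1.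
by rewrite -mulnb natrM -!mulrA.
Qed.

(** An odd level consists of (m+1)-sets, whose neighbours arise by deletion. Deleting a point
    outside [x] lowers the distance, deleting a point of [x] raises it. *)
Lemma sum_adj_dval_remove (z : X) (f : {set Omega} -> F) k : odd (dval x z) ->
  \sum_(w : X | adj w z) (dval x w == k)%:R * f (val w) =
  (k.+1 == dval x z)%:R * \sum_(e in val z :&: ~: val x) f (val z :\ e) +
  (k == (dval x z).+1)%:R * \sum_(e in val z :&: val x) f (val z :\ e).
Proof.
move=> oz; have [zk zI zD] := card_dval (erefl (dval x z)).
rewrite oz addn1 in zk.
(* By [dvalE] the level condition depends only on the underlying set, so it can be carried through
   the sum over points. *)
pose g (w : {set Omega}) :=
  ((#|w| == m + odd k) && (#|w :&: ~: val x| == uphalf k))%N%:R * f w.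
rewrite (eq_bigr (fun w : X => g (val w))); last by move=> w _; rewrite dvalE.
rewrite sum_adj_remove // (big_setID (val x)) /= addrC finset.setDE.
rewrite !big_distrr /=; congr (_ + _); apply: eq_bigr => e.
  rewrite !inE => /andP[ez ex]; rewrite /g (cardD1_succ ez zk).
  have -> : (val z :\ e) :&: ~: val x = (val z :&: ~: val x) :\ e.
    by apply/finset.setP => w; rewrite !inE andbA.
  have := cardsD1 e (val z :&: ~: val x); rewrite !inE ez ex zD => E.
  congr (_%:R * _); lia.
rewrite inE => /andP[ez ex]; rewrite /g (cardD1_succ ez zk).
have -> : (val z :\ e) :&: ~: val x = val z :&: ~: val x.
  by apply/finset.setP => w; rewrite !inE; case: eqP => // ->; rewrite ex !andbF.
rewrite zD; congr (_%:R * _); lia.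
Qed.

(** An even level consists of m-sets, whose neighbours arise by addition. Adding a point of [x]
    lowers the distance, adding one outside [x] raises it. *)
Lemma sum_adj_dval_add (z : X) (f : {set Omega} -> F) k : ~~ odd (dval x z) ->
  \sum_(w : X | adj w z) (dval x w == k)%:R * f (val w) =
  (k.+1 == dval x z)%:R * \sum_(e in val x :\: val z) f (e |: val z) +
  (k == (dval x z).+1)%:R * \sum_(e in ~: val x :\: val z) f (e |: val z).
Proof.
move=> /negPf oz; have [zk zI zD] := card_dval (erefl (dval x z)).
rewrite oz addn0 in zk.
pose g (w : {set Omega}) :=
  ((#|w| == m + odd k) && (#|w :&: ~: val x| == uphalf k))%N%:R * f w.
rewrite (eq_bigr (fun w : X => g (val w))); last by move=> w _; rewrite dvalE.
rewrite sum_adj_add // (big_setID (val x)) /=.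
have -> : ~: val z :&: val x = val x :\: val z by rewrite finset.setIC finset.setDE.
have -> : ~: val z :\: val x = ~: val x :\: val z.
  by rewrite !finset.setDE finset.setIC.
rewrite !big_distrr /=; congr (_ + _); apply: eq_bigr => e.
  rewrite !inE => /andP[ez ex]; rewrite /g cardsU1 ez zk.
  have -> : (e |: val z) :&: ~: val x = val z :&: ~: val x.
    by apply/finset.setP => w; rewrite !inE; case: eqP => // ->; rewrite ex !andbF.
  have d0 : (0 < dval x z)%N.
    rewrite lt0n; apply/eqP => d0; move: ex ez.
    by rewrite (dval0 xm d0) => ->.
  by rewrite zD; congr (_%:R * _); lia.
rewrite !inE => /andP[ez ex]; rewrite /g cardsU1 ez zk.
have -> : (e |: val z) :&: ~: val x = e |: (val z :&: ~: val x).
  by apply/finset.setP => w; rewrite !inE; case: eqP => // ->; rewrite ex.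
by rewrite cardsU1 !inE (negPf ez) zD; congr (_%:R * _); lia.
Qed.

Lemma block_adj_far k k' k'' l s : k'' <> k'.+1 -> k' <> k''.+1 ->
  block k k' l s *m adjmx Omega m F *m Estar F x k'' = 0.
Proof.
move=> n1 n2; apply/matrixP => a b; rewrite block_adj_Estar [RHS]mxE.
have [zk|] := eqVneq (dval x (enum_val b)) k''; last by rewrite andbF mul0r.
rewrite big1 ?mulr0 // => w /adj_dval; rewrite zk => wd.
by case: eqP => [e|]; rewrite ?mul0r //; case: wd; rewrite e; lia.
Qed.

(** Each neighbour at level [k'] of a column [z] at level [k'.+1] is [z] minus a point outside [x],
    so only the outer factor changes. *)
Lemma block_up_even k k' l s : ~~ odd k' ->
  block k k' l s *m adjmx Omega m F *m Estar F x k'.+1 =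
  ((uphalf k'.+1)%:R - s%:R) *: block k k'.+1 l s.
Proof.
move=> ok; apply/matrixP => a b; rewrite block_adj_Estar !mxE.
set y := enum_val a; set z := enum_val b.
case: (eqVneq (dval x y) k) => [_|_]; last by rewrite !mul0r mulr0.
case: (eqVneq (dval x z) k'.+1) => [zk|_]; last by rewrite !mul0r mulr0.
have [_ _ zD] := card_dval zk.
rewrite !mul1r (sum_adj_dval_remove (fun w => 'C(#|val y :&: w :&: val x|, l)%:R *
  'C(#|val y :&: w :&: ~: val x|, s)%:R)) zk //.
rewrite eqxx mul1r [_ == _.+2](_ : _ = false) ?mul0r ?addr0; last lia.
rewrite (eq_bigr (fun e => 'C(#|val y :&: val z :&: val x|, l)%:R *
  'C(#|val y :&: (val z :\ e) :&: ~: val x|, s)%:R)); last first.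
  move=> e; rewrite !inE => /andP[ez ex]; congr ('C(_, _)%:R * _).
  congr #|pred_of_set _|; apply/finset.setP => w; rewrite !inE.
  by case: eqP => // ->; rewrite (negPf ex) !andbF.
by rewrite -big_distrr /= sum_bin_remove zD mulrCA mulrA.
Qed.

Lemma block_down_odd k k' l s : odd k' ->
  block k k'.+1 l s *m adjmx Omega m F *m Estar F x k' =
  ((m - k'./2)%:R - l%:R) *: block k k' l s.
Proof.
move=> ok; apply/matrixP => a b; rewrite block_adj_Estar !mxE.
set y := enum_val a; set z := enum_val b.
case: (eqVneq (dval x y) k) => [_|_]; last by rewrite !mul0r mulr0.
case: (eqVneq (dval x z) k') => [zk|_]; last by rewrite !mul0r mulr0.
have [_ zI _] := card_dval zk.
rewrite !mul1r (sum_adj_dval_remove (fun w => 'C(#|val y :&: w :&: val x|, l)%:R *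
  'C(#|val y :&: w :&: ~: val x|, s)%:R)) zk //.
rewrite eqxx mul1r [_.+2 == _](_ : _ = false) ?mul0r ?add0r; last lia.
rewrite (eq_bigr (fun e => 'C(#|val y :&: (val z :\ e) :&: val x|, l)%:R *
  'C(#|val y :&: val z :&: ~: val x|, s)%:R)); last first.
  move=> e; rewrite !inE => /andP[ez ex]; congr (_ * 'C(_, _)%:R).
  congr #|pred_of_set _|; apply/finset.setP => w; rewrite !inE.
  by case: eqP => // ->; rewrite ex !andbF.
by rewrite -big_distrl /= sum_bin_remove zI mulrA.
Qed.

(** Here the neighbours are [z] plus a point of [x]; addition in the inner factor is what produces
    the index [l.-1]. *)
Lemma block_up_odd k k' l s : odd k' ->
  block k k' l s *m adjmx Omega m F *m Estar F x k'.+1 =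
  (m%:R - (m - k'.+1./2)%:R - l%:R) *: block k k'.+1 l s +
  ((l != 0)%:R * ((m - k./2)%:R - l.-1%:R)) *: block k k'.+1 l.-1 s.
Proof.
move=> ok; apply/matrixP => a b; rewrite block_adj_Estar !mxE.
set y := enum_val a; set z := enum_val b.
case: (eqVneq (dval x y) k) => [yk|_]; last by rewrite !mul0r !mulr0 addr0.
case: (eqVneq (dval x z) k'.+1) => [zk|_]; last by rewrite !mul0r !mulr0 addr0.
have [_ yI _] := card_dval yk; have [_ zI _] := card_dval zk.
rewrite !mul1r (sum_adj_dval_add (fun w => 'C(#|val y :&: w :&: val x|, l)%:R *
  'C(#|val y :&: w :&: ~: val x|, s)%:R)) zk ?negbK //.
rewrite eqxx mul1r [_ == _.+2](_ : _ = false) ?mul0r ?addr0; last lia.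
rewrite (eq_bigr (fun e => 'C(#|val y :&: (e |: val z) :&: val x|, l)%:R *
  'C(#|val y :&: val z :&: ~: val x|, s)%:R)); last first.
  move=> e; rewrite !inE => /andP[ez ex]; congr (_ * 'C(_, _)%:R).
  congr #|pred_of_set _|; apply/finset.setP => w; rewrite !inE.
  by case: eqP => // ->; rewrite ex !andbF.
by rewrite -big_distrl /= sum_bin_add zI yI xm mulrDl !mulrA.
Qed.

Lemma block_down_even k k' l s : ~~ odd k' ->
  block k k'.+1 l s *m adjmx Omega m F *m Estar F x k' =
  (#|~: val x|%:R - (uphalf k')%:R - s%:R) *: block k k' l s +
  ((s != 0)%:R * ((uphalf k)%:R - s.-1%:R)) *: block k k' l s.-1.
Proof.
move=> ok; apply/matrixP => a b; rewrite block_adj_Estar !mxE.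
set y := enum_val a; set z := enum_val b.
case: (eqVneq (dval x y) k) => [yk|_]; last by rewrite !mul0r !mulr0 addr0.
case: (eqVneq (dval x z) k') => [zk|_]; last by rewrite !mul0r !mulr0 addr0.
have [_ _ yD] := card_dval yk; have [_ _ zD] := card_dval zk.
rewrite !mul1r (sum_adj_dval_add (fun w => 'C(#|val y :&: w :&: val x|, l)%:R *
  'C(#|val y :&: w :&: ~: val x|, s)%:R)) zk //.
rewrite eqxx mul1r [_.+2 == _](_ : _ = false) ?mul0r ?add0r; last lia.
rewrite (eq_bigr (fun e => 'C(#|val y :&: val z :&: val x|, l)%:R *
  'C(#|val y :&: (e |: val z) :&: ~: val x|, s)%:R)); last first.
  move=> e; rewrite !inE => /andP[ez ex]; congr ('C(_, _)%:R * _).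
  congr #|pred_of_set _|; apply/finset.setP => w; rewrite !inE.
  by case: eqP => // ->; rewrite (negPf ex) !andbF.
rewrite -big_distrr /= sum_bin_add zD yD; ring.
Qed.

End Blocks.

(** * Generated subalgebras and transposition *)

Section GeneratedSubalgebra.

Variables (F : fieldType) (N : nat).

Lemma is_subalgebra_gen (G : set 'M[F]_N) : is_subalgebra (subalgebra_gen G).
Proof.
split=> [S [[]] //|a P Q TP TQ S SG|P Q TP TQ S SG]; have [[_ Slin Smul] _] := SG.
  by apply: Slin; [apply: TP | apply: TQ].
by apply: Smul; [apply: TP | apply: TQ].
Qed.

(** Transposition reverses products, so the matrices whose transpose is generated form a subalgebra
    containing [G]. *)
Lemma subalgebra_gen_tr (G : set 'M[F]_N) (B : 'M[F]_N) :
  (forall P, G P -> G P^T) -> subalgebra_gen G B -> subalgebra_gen G B^T.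
Proof.
have [T1 Tlin Tmul] := is_subalgebra_gen G.
move=> Gtr; apply: (@smallest_sub _ _ _ [set P | subalgebra_gen G P^T]%classic).
  split=> [|a P Q|P Q] /=; first by rewrite trmx1.
    by rewrite linearP; apply: Tlin.
  by rewrite trmx_mul => TP TQ; apply: Tmul.
by move=> P GP; apply: (sub_smallest (@subset_refl _ _)); apply: Gtr.
Qed.

End GeneratedSubalgebra.

(** * Vanishing of blocks, and the idempotents as blocks *)

Section Terwilliger.

Variables (Omega : finType) (m : nat) (F : numFieldType).
Local Notation X := (vertex Omega m).
Local Notation MatX := 'M[F]_#|{: X}|.

Variable x : X.
Hypothesis xm : #|val x| = m.

Local Notation block := (block F x).
Local Notation T := (Terwilliger F x).

Lemma block_tr k k' l s : (block k k' l s)^T = block k' k l s.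
Proof.
by apply/matrixP => a b; rewrite !mxE andbC (finset.setIC (val (enum_val b))).
Qed.

Lemma block_large k k' l s : (2 * m + 2 <= k)%N || (2 * m + 2 <= k')%N ->
  block k k' l s = 0.
Proof.
move=> large; apply/matrixP => a b; rewrite !mxE.
have := dval_lt xm (enum_val a); have := dval_lt xm (enum_val b).
case: eqP => [->|_]; last by rewrite mul0r.
case: eqP => [->|_]; last by rewrite mul0r.
lia.
Qed.

(** The intersection is too small for the binomial. This lets [l] and [s] range over all naturals
    and gives the descents a zero block to start from. *)
Lemma block_small k k' l s :
  (minn (m - k./2) (m - k'./2) < l)%N || (minn (uphalf k) (uphalf k') < s)%N ->
  block k k' l s = 0.
Proof.
move=> small; apply/matrixP => a b; rewrite !mxE.
set y := enum_val a; set z := enum_val b.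
have [yk|_] := eqVneq (dval x y) k; last by rewrite mul0r.
have [zk|_] := eqVneq (dval x z) k'; last by rewrite mul0r.
have [_ yI yD] := card_dval xm yk; have [_ zI zD] := card_dval xm zk.
have leI (V : {set Omega}) :
    (#|val y :&: val z :&: V| <= minn #|val y :&: V| #|val z :&: V|)%N.
  by rewrite leq_min !subset_leq_card // finset.setSI //
    ?finset.subsetIl ?finset.subsetIr.
have := leI (val x); have := leI (~: val x).
rewrite yI yD zI zD => leD leI'.
case/orP: small => lt; last by rewrite (bin_small (leq_ltn_trans leD lt)) !mulr0.
by rewrite (bin_small (leq_ltn_trans leI' lt)) mul0r mulr0.
Qed.

(** At the top indices the binomials detect full intersection inside and outside [x], which for two
    vertices of one level means equality. *)
Lemma Estar_block k : Estar F x k = block k k (m - k./2) (uphalf k).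
Proof.
apply/matrixP => a b; rewrite !mxE in_Gamma //.
have [->|ab] := eqVneq a b.
  rewrite andbb !finset.setIid; case: eqP => [yk|_]; last by rewrite mul0r.
  by have [_ -> ->] := card_dval xm yk; rewrite !binn !mulr1.
set y := enum_val a; set z := enum_val b.
have yz : val y != val z by apply: contra_neq ab => /val_inj/enum_val_inj.
have [yk|_] := eqVneq (dval x y) k; last by rewrite mul0r.
have [zk|_] := eqVneq (dval x z) k; last by rewrite mul0r.
have [ym yI yD] := card_dval xm yk; have [zm zI zD] := card_dval xm zk.
have [lt|leI] := ltnP #|val y :&: val z :&: val x| (m - k./2).
  by rewrite bin_small // mul0r mulr0.
have [lt|leD] := ltnP #|val y :&: val z :&: ~: val x| (uphalf k).
  by rewrite [X in _ * X]mulrC bin_small // mul0r mulr0.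
case/negP: yz; have := cardsID (val x) (val y :&: val z).
have := cardsID (val x) (val y); rewrite yI !finset.setDE yD => c1 c2.
have yzy : val y :&: val z == val y.
  by rewrite eqEcard finset.subsetIl; lia.
rewrite eqEcard; apply/andP; split; last by rewrite zm ym.
by apply/finset.setIidPl/eqP.
Qed.

(** * All blocks lie in the Terwilliger algebra *)

Lemma Terwilliger_subalgebra : is_subalgebra T.
Proof. exact: is_subalgebra_gen. Qed.

Lemma Terwilliger0 : T 0.
Proof.
have [T1 Tlin _] := Terwilliger_subalgebra.
by have := Tlin (-1) 1%:M 1%:M T1 T1; rewrite scaleN1r addNr.
Qed.

Lemma TerwilligerZ c P : T P -> T (c *: P).
Proof.
have [_ Tlin _] := Terwilliger_subalgebra; move=> TP.
by rewrite -[_ *: P]addr0; apply: Tlin => //; exact: Terwilliger0.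
Qed.

Lemma Terwilliger_solve P Q c d : T P -> T (c *: P + d *: Q) -> d != 0 -> T Q.
Proof.
have [_ Tlin _] := Terwilliger_subalgebra => TP TQ d0.
have := TerwilligerZ d^-1 (Tlin (- c) _ _ TP TQ).
by rewrite scaleNr addKr scalerA mulVf // scale1r.
Qed.

Lemma Estar_Terwilliger k : T (Estar F x k).
Proof.
have [lk|kl] := ltnP k (2 * m + 2); last first.
  by rewrite Estar_block block_large ?kl //; exact: Terwilliger0.
by apply: (sub_smallest (@subset_refl _ _)); right; exists (Ordinal lk).
Qed.

Lemma Terwilliger_step P k : T P -> T (P *m adjmx Omega m F *m Estar F x k).
Proof.
have [_ _ Tmul] := Terwilliger_subalgebra => TP.
apply: (Tmul _ _ _ (Estar_Terwilliger k)); apply: Tmul TP _.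
by apply: (sub_smallest (@subset_refl _ _)); left.
Qed.

Lemma Terwilliger_tr P : T P -> T P^T.
Proof.
apply: subalgebra_gen_tr => _ [->|[k ->]]; [left|right; exists k].
  by apply/matrixP => a b; rewrite !mxE /adj orbC.
by rewrite Estar_block block_tr.
Qed.

Lemma natr_subr_neq0 (i j : nat) : i <> j -> i%:R - j%:R != 0 :> F.
Proof. by move=> ij; rewrite subr_eq0 eqr_nat; apply/eqP. Qed.

(** Edges between an odd level and the next one move a point of [x]: odd [k] steps up and back,
    positive even [k] down and back. In both cases the wanted block gets the coefficient (m - k/2 -
    l)^2. *)
Lemma diag_inner_pred k l s : (l < m - k./2)%N ->
  T (block k k l.+1 s) -> T (block k k l s).
Proof.
move=> la TB; have [k0|k0] := posnP k.
  (* There is no level below 0, but level 0 is {x}, where changing [l] only rescales the block. *)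
  rewrite k0 in la TB *.
  have -> : block 0 0 l s = 'C(m, l)%:R *: block 0 0 m s.
    apply/matrixP => a b; rewrite !mxE.
    case: eqP => [/(dval0 xm) ->|_]; last by rewrite !mul0r mulr0.
    case: eqP => [/(dval0 xm) ->|_]; last by rewrite !mul0r mulr0.
    by rewrite !finset.setIid xm binn !mul1r.
  apply: TerwilligerZ; have [s0|s0] := posnP s.
    by have := Estar_Terwilliger 0; rewrite Estar_block subn0 s0.
  by rewrite block_small ?s0 ?orbT //; exact: Terwilliger0.
have [ok|ok] := boolP (odd k).
  have := Terwilliger_step k (Terwilliger_step k.+1 TB).
  rewrite (block_up_odd _ xm) // !mulmxDl -!scalemxAl !(block_down_odd _ xm) //.
  rewrite !scalerA mul1r /= => TQ; apply: Terwilliger_solve TB TQ _.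
  by rewrite mulf_neq0 // natr_subr_neq0 //; lia.
case: k la TB k0 ok => // k la TB _; rewrite /= negbK => ok.
have := Terwilliger_step k.+1 (Terwilliger_step k TB).
rewrite (block_down_odd _ xm) // -!scalemxAl (block_up_odd _ xm) // scalerDr.
rewrite !scalerA mul1r => TQ; apply: Terwilliger_solve TB TQ _.
by rewrite mulf_neq0 // natr_subr_neq0 //; lia.
Qed.

(** Edges between an even level and the next one move a point outside [x], so the directions are
    swapped; the coefficient is (uphalf k - s)^2. *)
Lemma diag_outer_pred k l s : (s < uphalf k)%N ->
  T (block k k l s.+1) -> T (block k k l s).
Proof.
move=> sb TB; have [ok|ok] := boolP (odd k); last first.
  have := Terwilliger_step k (Terwilliger_step k.+1 TB).
  rewrite (block_up_even _ xm) // -!scalemxAl (block_down_even _ xm) // scalerDr.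
  rewrite !scalerA mul1r => TQ; apply: Terwilliger_solve TB TQ _.
  by rewrite mulf_neq0 // natr_subr_neq0 //; lia.
case: k sb TB ok => // k sb TB; rewrite [odd _]/= => ok.
have := Terwilliger_step k.+1 (Terwilliger_step k TB).
rewrite (block_down_even _ xm) // !mulmxDl -!scalemxAl !(block_up_even _ xm) //.
rewrite !scalerA mul1r => TQ; apply: Terwilliger_solve TB TQ _.
by rewrite mulf_neq0 // natr_subr_neq0 //; lia.
Qed.

Lemma block_diag_Terwilliger k l s : T (block k k l s).
Proof.
(* [d] is fuel for a downward induction: when it runs out, the index exceeds the top one and the
   block is zero. *)
have inner d l' : (m - k./2 < l' + d)%N -> T (block k k l' (uphalf k)).
  elim: d l' => [|d IH] l' ld.
    rewrite block_small; first exact: Terwilliger0.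
    by rewrite minnn -[l']addn0 ld.
  have [la|al] := ltnP l' (m - k./2).
    by apply: diag_inner_pred => //; apply: IH; rewrite addSnnS.
  have [->|/eqP ne] := eqVneq l' (m - k./2)%N.
    by rewrite -Estar_block; exact: Estar_Terwilliger.
  by rewrite block_small; [exact: Terwilliger0 | lia].
suff outer d s' : (uphalf k < s' + d)%N -> T (block k k l s').
  by apply: (outer (uphalf k).+1); rewrite addnS ltnS leq_addl.
elim: d s' => [|d IH] s' sd.
  by rewrite block_small; [exact: Terwilliger0 | lia].
have [sb|bs] := ltnP s' (uphalf k).
  by apply: diag_outer_pred => //; apply: IH; rewrite addSnnS.
have [->|/eqP ne] := eqVneq s' (uphalf k).
  by apply: (inner (m - k./2).+1); rewrite addnS ltnS leq_addl.
by rewrite block_small; [exact: Terwilliger0 | lia].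
Qed.

(** The bound k <= k' keeps the pivots nonzero. For even k' the pivot is uphalf (k'+1) - s with s <=
    uphalf k; for odd k' it is m - k/2 - l' with l' <= m - (k'+1)/2. *)
Lemma block_next_Terwilliger k k' : (k <= k')%N ->
  (forall l s, T (block k k' l s)) -> forall l s, T (block k k'.+1 l s).
Proof.
move=> kk' TB l s.
(* Past the last level the block vanishes; otherwise, for odd k', the subtraction in m - (k'+1)/2 is
   not truncated, as the strict inequality for the pivot requires. *)
have [large|lk'] := leqP (2 * m + 2) k'.+1.
  by rewrite block_large ?large ?orbT //; exact: Terwilliger0.
have [ok|ok] := boolP (odd k'); last first.
  have [sb|bs] := leqP s (uphalf k); last first.
    by rewrite block_small; [exact: Terwilliger0 | lia].
  have := Terwilliger_step k'.+1 (TB l s); rewrite (block_up_even _ xm) // => TQ.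
  apply: (Terwilliger_solve (c := 0) Terwilliger0); first by rewrite scaler0 add0r; exact: TQ.
  by apply: natr_subr_neq0; have := uphalf_leq kk'; lia.
suff desc d l' : (m - k'.+1./2 < l' + d)%N -> T (block k k'.+1 l' s).
  by apply: (desc (m - k'.+1./2).+1); rewrite addnS ltnS leq_addl.
elim: d l' => [|d IH] l' ld.
  by rewrite block_small; [exact: Terwilliger0 | lia].
have [la|al] := leqP l' (m - k'.+1./2); last first.
  by rewrite block_small; [exact: Terwilliger0 | lia].
have TB1 : T (block k k'.+1 l'.+1 s) by apply: IH; rewrite addSnnS.
have := Terwilliger_step k'.+1 (TB l'.+1 s).
rewrite (block_up_odd _ xm) // mul1r => TQ; apply: Terwilliger_solve TB1 TQ _.
by apply: natr_subr_neq0; have := half_leq kk'; lia.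
Qed.

Lemma block_Terwilliger k k' l s : T (block k k' l s).
Proof.
wlog kk' : k k' / (k <= k')%N => [wl|].
  have [|/ltnW] := leqP k k'; first exact: wl.
  by move/wl/Terwilliger_tr; rewrite block_tr.
rewrite -(subnKC kk'); elim: (k' - k)%N l s => [|d IH] l s.
  by rewrite addn0; exact: block_diag_Terwilliger.
by rewrite addnS; apply: block_next_Terwilliger; rewrite ?leq_addr.
Qed.

(** * The space M is spanned by the blocks and stable under the generators *)

Lemma Lmx_tens k k' l s :
  Lmx (Cmx F (val x) (m - k./2) (m - k'./2) l *t
       Cmx F (~: val x) (uphalf k) (uphalf k') s) = block k k' l s.
Proof.
apply/matrixP => a b; rewrite !mxE -!in_Gamma // -!ident_isSome //.
case E1: (ident _ k _) => [r|]; last by rewrite mul0r.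
case E2: (ident _ k' _) => [t|]; last by rewrite mul0r.
have /ident_Some[_ rI rD] := E1; have /ident_Some[_ tI tD] := E2.
rewrite mul1r -[r]mxtens_unindexK -[t]mxtens_unindexK.
rewrite [mxtens_unindex r]surjective_pairing [mxtens_unindex t]surjective_pairing.
rewrite tensmxE !mxE rI rD tI tD !finset.setDE.
have meetI (A B V : {set Omega}) : A :&: V :&: (B :&: V) = A :&: B :&: V.
  by rewrite finset.setIACA finset.setIid.
by rewrite !meetI.
Qed.

Lemma block_Mspace k k' l s : block k k' l s \in Mspace F x.
Proof.
have [kl|lk] := leqP (2 * m + 2) k; first by rewrite block_large ?kl ?mem0v.
have [kl'|lk'] := leqP (2 * m + 2) k'.
  by rewrite block_large ?kl' ?orbT ?mem0v.
have [ls|sl] := leqP l (minn (m - k./2) (m - k'./2)); last first.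
  by rewrite block_small ?sl ?mem0v.
have [sb|bs] := leqP s (minn (uphalf k) (uphalf k')); last first.
  by rewrite block_small ?bs ?orbT ?mem0v.
rewrite -Lmx_tens /Mspace.
rewrite memvE; apply: (sumv_sup (Ordinal lk, Ordinal lk')) => //=.
rewrite -memvE -[Lmx _](lfunE (@Lmx Omega m F x k k')).
apply: memv_img; apply: memv_span; apply/allpairsP.
by exists (l, s); split; rewrite ?mem_iota.
Qed.

Lemma Mspace_ind (S : MatX -> Prop) :
    S 0 -> (forall c P Q, S P -> S Q -> S (c *: P + Q)) ->
    (forall k k' l s, S (block k k' l s)) ->
  forall B, B \in Mspace F x -> S B.
Proof.
move=> S0 Slin Sblock B /memv_sumP[u uV ->].
have SD P Q : S P -> S Q -> S (P + Q).
  by move=> SP SQ; rewrite -[P]scale1r; apply: Slin.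
apply: (big_ind S) => // -[i j] _; have /memv_imgP[M MV ->] := uV (i, j) isT.
rewrite lfunE /=; move: MV; rewrite /Mblock.
set s := [seq _ | _ <- _, _ <- _] => /(coord_span (X := in_tuple s)) ->.
rewrite linear_sum; apply: (big_ind S) => // t _.
rewrite linearZ -[X in S X]addr0; apply: Slin => //.
have /allpairsP[[l q] [_ _ ->]] : s`_t \in s by apply: mem_nth.
by have := Sblock i j l q; rewrite -Lmx_tens.
Qed.

Lemma sum_Estar : \sum_(k < 2 * m + 2) Estar F x k = 1%:M.
Proof.
apply/matrixP => a b; rewrite summxE !mxE.
rewrite (bigD1 (Ordinal (dval_lt xm (enum_val a)))) //= big1 => [|k /eqP ne].
  by rewrite mxE in_Gamma // eqxx andbT addr0.
rewrite mxE in_Gamma //; have [ek|_] := eqVneq (dval x _) k; last by rewrite andbF.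
by case: ne; apply: val_inj.
Qed.

Lemma Mspace_1 : 1%:M \in Mspace F x.
Proof.
by rewrite -sum_Estar; apply: memv_suml => k _; rewrite Estar_block block_Mspace.
Qed.

Lemma Mspace_Estar B k : B \in Mspace F x -> B *m Estar F x k \in Mspace F x.
Proof.
move: B; apply: Mspace_ind => [|c P Q PM QM|k1 k' l s].
- by rewrite mul0mx mem0v.
- by rewrite mulmxDl -scalemxAl memvD ?memvZ.
by rewrite (block_Estar _ xm) memvZ ?block_Mspace.
Qed.

Lemma Mspace_adj B : B \in Mspace F x -> B *m adjmx Omega m F \in Mspace F x.
Proof.
move: B; apply: Mspace_ind => [|c P Q PM QM|k k' l s].
- by rewrite mul0mx mem0v.
- by rewrite mulmxDl -scalemxAl memvD ?memvZ.
(* Splitting the product by column level leaves only the two neighbouring levels of [k'], where the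
   step formulas apply. *)
rewrite -[X in X \in _]mulmx1 -sum_Estar mulmx_sumr.
apply: memv_suml => j _; have [->|/eqP nj] := eqVneq (j : nat) k'.+1.
  have [ok|ok] := boolP (odd k').
    by rewrite (block_up_odd _ xm) // memvD ?memvZ ?block_Mspace.
  by rewrite (block_up_even _ xm) // memvZ ?block_Mspace.
have [->|/eqP nj'] := eqVneq k' j.+1.
  have [ok|ok] := boolP (odd j).
    by rewrite (block_down_odd _ xm) // memvZ ?block_Mspace.
  by rewrite (block_down_even _ xm) // memvD ?memvZ ?block_Mspace.
by rewrite (block_adj_far _ xm) ?mem0v.
Qed.

Lemma Terwilliger_Mspace : T = [set` Mspace F x]%classic.
Proof.
have [_ Tlin _] := Terwilliger_subalgebra.
apply/seteqP; split=> B /=; last first.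
  by apply: Mspace_ind => //; [exact: Terwilliger0 | exact: block_Terwilliger].
(* Closure of M under products is not checked directly: the matrices that preserve M by right
   multiplication form a subalgebra containing the generators, and 1 in M then gives B = 1·B in
   M. *)
suff: (T `<=` [set B | forall P, P \in Mspace F x -> P *m B \in Mspace F x])%classic.
  by move=> sub /sub /(_ _ Mspace_1); rewrite mul1mx.
apply: smallest_sub => [|_ [->|[k ->]] P] /=.
- split=> [P|c P Q PM QM B' B'M|P Q PM QM B' B'M] /=; first by rewrite mulmx1.
    by rewrite mulmxDr -scalemxAr memvD ?memvZ ?PM ?QM.
  by rewrite mulmxA QM ?PM.
- exact: Mspace_adj.
exact: Mspace_Estar.
Qed.

End Terwilliger.

Theorem theorem3p4 (R : realType) (Omega : finType) (n m : nat)
    (hn : (3 * m <= n)%N) (hOmega : #|Omega| = n)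
    (x : vertex Omega m) (hx : #|val x| = m) :
  Terwilliger R[i]%C x = [set` Mspace R[i]%C x]%classic.
Proof. exact: (@Terwilliger_Mspace Omega m R[i]%C x hx). Qed.
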